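(* Let $(A_n)_{n\ge 0}$ be a sequence of complex numbers, and let $a,b,c,x\in\mathbb{C}$ with $c\notin\{0,-1,-2,\dots\}$. Then for every $n\ge 0$ the Gauss-Appell polynomials ${}_{{}_2F_1}A_n(a,b;c;x)=(x\hat\chi+\hat a)^n\phi_0\psi_0$ satisfy $${}_{{}_2F_1}A_n(a,b;c;x)=\sum_{k=0}^{n}\binom{n}{k}\frac{x^{k}(a)_k(b)_kA_{n-k}}{(c)_k},$$ or equivalently $${}_{{}_2F_1}A_n(a,b;c;x)=\sum_{k=0}^{n}\binom{n}{k}\frac{x^{n-k}(a)_{n-k}(b)_{n-k}A_{k}}{(c)_{n-k}}.$$
   Context: $(r)_k=r(r+1)\cdots(r+k-1)$, $(r)_0=1$, is the Pochhammer symbol. Umbral convention: $\hat\chi$ and $\hat a$ are commuting symbols. For a polynomial $P$ in $\hat\chi,\hat a$ with complex coefficients, $P\,\phi_0\psi_0$ denotes the complex number obtained by expanding $P$ in monomials and applying the linear functional determined by $\hat\chi^k\hat a^j\,\phi_0\psi_0=\frac{(a)_k(b)_k}{(c)_k}A_j$ for all $k,j\ge 0$. The Gauss-Appell polynomials associated with $(A_n)$ are defined for $n\ge 0$ by ${}_{{}_2F_1}A_n(a,b;c;x)=(x\hat\chi+\hat a)^n\phi_0\psi_0$. *)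

(* Defs.v *)
From mathcomp Require Import all_boot all_order all_algebra.
From mathcomp Require Import complex.
From mathcomp Require Import reals.
From mathcomp Require Import mpoly.

Set Implicit Arguments.
Unset Strict Implicit.
Unset Printing Implicit Defensive.

Import GRing.Theory.
Local Open Scope ring_scope.

Definition pochhammer (C : fieldType) (r : C) (k : nat) : C :=
  \prod_(i < k) (r + i%:R).

Definition chi_hat (C : fieldType) : {mpoly C[2]} := 'X_ord0.
Definition a_hat (C : fieldType) : {mpoly C[2]} := 'X_ord_max.

(* The value of the umbral functional on chi_hat ^+ k * a_hat ^+ j. *)
Definition umbral_moment (C : fieldType) (A : nat -> C) (a b c : C)
    (k j : nat) : C :=
  pochhammer a k * pochhammer b k / pochhammer c k * A j.

(* P phi_0 psi_0: [m ord0] and [m ord_max] are the exponents of chi_hat and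
   a_hat in the monomial 'X_[m], and P@_m is the coefficient of 'X_[m] in P. *)
Definition umbral_eval (C : fieldType) (A : nat -> C) (a b c : C)
    (P : {mpoly C[2]}) : C :=
  \sum_(m <- msupp P) P@_m * umbral_moment A a b c (m ord0) (m ord_max).

Definition gauss_appell (C : fieldType) (A : nat -> C) (n : nat)
    (a b c x : C) : C :=
  umbral_eval A a b c ((x *: chi_hat C + a_hat C) ^+ n).

(* Main.v *)
Require Import Defs.
From mathcomp Require Import all_boot all_order all_algebra.
From mathcomp Require Import complex.
From mathcomp Require Import reals.
From mathcomp Require Import mpoly ssrcomplements.

Set Implicit Arguments.
Unset Strict Implicit.
Unset Printing Implicit Defensive.

Import GRing.Theory.
Local Open Scope ring_scope.

(** The umbral evaluation is a linear functional on polynomials in two commuting variables, and it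
    sends each monomial to its prescribed moment. Applying it termwise to the binomial expansion of
    the n-th power gives the form with [x ^+ (n - k)]; the other form follows by reversing the
    summation. [umbral_evalD], [umbral_evalZ] and [umbral_eval_monomial] carry the argument. *)

Section UmbralEval.
Variables (C : fieldType) (A : nat -> C) (a b c : C).

Local Notation ev := (umbral_eval A a b c).

(** The support varies with [P], which obstructs linearity; over a fixed index set, sums for
    different polynomials can be compared coefficientwise. The added monomials have coefficient
    zero. *)
Lemma umbral_evalwE (P : {mpoly C[2]}) (d : nat) : (msize P <= d)%N ->
  ev P = \sum_(m : 'X_{1..2 < d})
           P@_m * umbral_moment A a b c (m ord0) (m ord_max).
Proof.
move=> le_Pd; pose I : subFinType _ := 'X_{1..2 < d}.
rewrite /umbral_eval (big_mksub I) ?msupp_uniq //=; first last.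
  by move=> m /msize_mdeg_lt /leq_trans; apply.
by rewrite big_rmcond //= => m /memN_msupp_eq0 ->; rewrite mul0r.
Qed.

Lemma umbral_eval0 : ev 0 = 0.
Proof. by rewrite /umbral_eval msupp0 big_nil. Qed.

Lemma umbral_evalD : {morph ev : P Q / P + Q}.
Proof.
(* One bound for all three polynomials puts their sums on the same index set. *)
move=> P Q; set d := maxn (msize (P + Q)) (maxn (msize P) (msize Q)).
rewrite !(@umbral_evalwE _ d) ?leq_max ?leqnn ?orbT // -big_split /=.
by apply: eq_bigr => m _; rewrite mcoeffD mulrDl.
Qed.

Lemma umbral_evalZ (z : C) (P : {mpoly C[2]}) : ev (z *: P) = z * ev P.
Proof.
set d := maxn (msize (z *: P)) (msize P).
rewrite !(@umbral_evalwE _ d) ?leq_max ?leqnn ?orbT // mulr_sumr.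
by apply: eq_bigr => m _; rewrite mcoeffZ -mulrA.
Qed.

Lemma umbral_eval_monomial (k j : nat) :
  ev (chi_hat C ^+ k * a_hat C ^+ j) = umbral_moment A a b c k j.
Proof.
(* The product is a single monomial with coefficient 1, so its support is a singleton. *)
rewrite /chi_hat /a_hat !mpolyXn -mpolyXD /umbral_eval msuppX big_seq1.
by rewrite mcoeffX eqxx mul1r !mnmDE !mulmnE !mnm1E /= !mul1n !mul0n addn0 add0n.
Qed.

Lemma gauss_appellE (n : nat) (x : C) :
  gauss_appell A n a b c x =
    \sum_(k < n.+1) 'C(n, k)%:R *
      (x ^+ (n - k) * umbral_moment A a b c (n - k) k).
Proof.
rewrite /gauss_appell exprDn (big_morph ev umbral_evalD umbral_eval0).
apply: eq_bigr => k _.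
by rewrite exprZn -scalerAl -scaler_nat !umbral_evalZ umbral_eval_monomial.
Qed.

End UmbralEval.

Theorem mainTheorem2 (R : realType) (A : nat -> R[i]) (a b c x : R[i])
    (hc : forall m : nat, c != - m%:R) (n : nat) :
  gauss_appell A n a b c x =
    \sum_(0 <= k < n.+1) ('C(n, k))%:R *
      (x ^+ k * pochhammer a k * pochhammer b k * A (n - k)%N
         / pochhammer c k)
  /\
  gauss_appell A n a b c x =
    \sum_(0 <= k < n.+1) ('C(n, k))%:R *
      (x ^+ (n - k) * pochhammer a (n - k) * pochhammer b (n - k) * A k
         / pochhammer c (n - k)).
Proof.
have second : gauss_appell A n a b c x =
    \sum_(0 <= k < n.+1) ('C(n, k))%:R *
      (x ^+ (n - k) * pochhammer a (n - k) * pochhammer b (n - k) * A k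
         / pochhammer c (n - k)).
  rewrite gauss_appellE big_mkord; apply: eq_bigr => k _.
  by rewrite /umbral_moment !mulrA [RHS]mulrAC.
(* The reversal replaces [k] by [n.+1 - k.+1], that is [n - k]; the binomial coefficient is
   symmetric under this. *)
split=> //; rewrite second big_nat_rev /= add0n.
apply: eq_big_nat => k /andP[_ lt_kn].
by rewrite subSS subKn // bin_sub.
Qed.
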